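(* Let $0 \neq \mu \in \Gamma$, let $p_\mu = e_\mu e_{3\mu} - e_{2\mu}^2 - \mu e_{4\mu} \in U(W_\Gamma)$, let $B = \Phi(U(W_\Gamma))$, and let $I = B\,\Phi(p_\mu)\,B$ be the two-sided ideal of $B$ generated by $\Phi(p_\mu)$. Then $I$ is not finitely generated as a left ideal of $B$ and is not finitely generated as a right ideal of $B$.
   Context: $\Bbbk$ is an algebraically closed field of characteristic zero and $\Gamma$ is a finitely generated additive subgroup of $\Bbbk$. $W_\Gamma$ is the Lie algebra over $\Bbbk$ with basis $\{e_\nu \mid \nu \in \Gamma\}$ and bracket $[e_\mu, e_\nu] = (\nu - \mu) e_{\nu+\mu}$; $U(W_\Gamma)$ is its enveloping algebra. $T = \Bbbk[a,b]\rtimes\Gamma = \bigoplus_{\gamma\in\Gamma}\Bbbk[a,b]t^\gamma$, with $t^\gamma t^\delta = t^{\gamma+\delta}$ and $t^\gamma p(a,b) = p(a+\gamma,b)t^\gamma$. $\Phi: U(W_\Gamma)\to T$ is the algebra anti-homomorphism with $\Phi(e_\mu) = (a+b\mu)t^\mu$ for $\mu \in \Gamma$; its image $B$ is a subalgebra of $T$. *)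

(* Defs.v *)
From HB Require Import structures.
From mathcomp Require Import all_boot all_order all_algebra finmap.
From mathcomp Require Import boolp classical_sets.
From mathcomp Require Import monalg ring.

Set Implicit Arguments.
Unset Strict Implicit.
Unset Printing Implicit Defensive.

Import GRing.Theory.

Local Open Scope ring_scope.
Local Open Scope quotient_scope.

Section Ideals.
Variables (A : nzRingType) (B S : set A).

(* For B a unital subring of A, these are the ideals of B generated by S: the
   finite sums of terms u * s * v (resp. u * s, s * v) with u, v in B, s in S. *)

Inductive ideal_gen : set A :=
| ideal_gen0 : ideal_gen 0
| ideal_genD u s v x : B u -> S s -> B v -> ideal_gen x ->
    ideal_gen (u * s * v + x).

Inductive left_ideal_gen : set A :=
| left_ideal_gen0 : left_ideal_gen 0
| left_ideal_genD u s x : B u -> S s -> left_ideal_gen x ->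
    left_ideal_gen (u * s + x).

Inductive right_ideal_gen : set A :=
| right_ideal_gen0 : right_ideal_gen 0
| right_ideal_genD s v x : S s -> B v -> right_ideal_gen x ->
    right_ideal_gen (s * v + x).

End Ideals.

Lemma ideal_gen_add (A : nzRingType) (B S : set A) x y :
  ideal_gen B S x -> ideal_gen B S y -> ideal_gen B S (x + y).
Proof.
by move=> + Iy; elim=> [|u s v z Bu Ss Bv _ IH]; rewrite ?add0r // -addrA;
  apply: ideal_genD.
Qed.

Lemma ideal_gen_mul (A : nzRingType) (B S : set A) u v x :
  (forall y z, B y -> B z -> B (y * z)) -> B u -> B v ->
  ideal_gen B S x -> ideal_gen B S (u * x * v).
Proof.
move=> BM Bu Bv; elim=> [|u' s v' z Bu' Ss Bv' _ IH].
  by rewrite mulr0 mul0r; apply: ideal_gen0.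
rewrite mulrDr mulrDl !mulrA -(mulrA _ v' v).
by apply: ideal_genD => //; apply: BM.
Qed.

Definition fg_left_ideal (A : nzRingType) (B I : set A) : Prop :=
  exists s : seq A, (forall x, x \in s -> I x) /\
    I = left_ideal_gen B [set x | x \in s].

Definition fg_right_ideal (A : nzRingType) (B I : set A) : Prop :=
  exists s : seq A, (forall x, x \in s -> I x) /\
    I = right_ideal_gen B [set x | x \in s].

HB.mixin Record Lmodule_isLie (k : fieldType) L of GRing.Lmodule k L := {
  lie : L -> L -> L;
  lie_linearl : forall z, linear (lie^~ z);
  lie_linearr : forall z, linear (lie z);
  lie_alt : forall x, lie x x = 0;
  lie_jacobi : forall x y z,
    lie x (lie y z) + lie y (lie z x) + lie z (lie x y) = 0
}.

#[short(type="lieAlgType")]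
HB.structure Definition LieAlgebra (k : fieldType) :=
  { L of GRing.Lmodule k L & Lmodule_isLie k L }.

Fact rmorph_commutator (R S : nzRingType) (g : {rmorphism R -> S}) x y :
  g (x * y - y * x) = g x * g y - g y * g x.
Proof. by rewrite rmorphB !rmorphM. Qed.

Section FreeAlgebra.
Variables (k : fieldType) (X : choiceType).

(* {malg k[M]} is the monoid algebra of M; the noncommutative words in X form
   the free monoid {fmonom X}, with generators fmu x. *)
Definition freeAlg := {malg k[{fmonom X}]}.
HB.instance Definition _ := GRing.Lalgebra.on freeAlg.

Lemma freeAlg_scalerAr c (p q : freeAlg) : c *: (p * q) = p * (c *: q).
Proof.
apply/malgP => m; rewrite mcoeffZ.
apply: etrans (esym (mcoeffMlw m (fsubset_refl (msupp p)) (msuppZ_le c q))).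
rewrite mcoeffMl mulr_sumr; apply: eq_bigr => i _; rewrite mulr_sumr.
by apply: eq_bigr => j _; rewrite mcoeffZ mulrnAr mulrCA.
Qed.
HB.instance Definition _ := GRing.Lalgebra_isAlgebra.Build k freeAlg
  freeAlg_scalerAr.

Definition fgen (x : X) : freeAlg := << fmu x >>.

Section Eval.
Variables (A : algType k) (f : X -> A).

Definition fword (m : {fmonom X}) : A := \prod_(x <- m) f x.

Fact fword_mmorphism : mmorphism fword.
Proof. by split=> [m n|]; rewrite /fword ?fmM ?big_cat ?fm1 ?big_nil. Qed.
HB.instance Definition _ := isMultiplicative.Build _ _ fword fword_mmorphism.

Definition free_eval (p : freeAlg) : A := mmap (in_alg A) fword p.

Lemma free_eval_zmod : zmod_morphism free_eval.
Proof. by move=> p q; rewrite /free_eval mmapB. Qed.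
HB.instance Definition _ := GRing.isZmodMorphism.Build _ _ free_eval
  free_eval_zmod.

Lemma free_eval_monoid : monoid_morphism free_eval.
Proof.
have [|hM h1] := @commr_mmap_is_multiplicative _ _ _ (in_alg A) fword; last by split.
by move=> g m m'; rewrite /GRing.comm /= mulr_algl mulr_algr.
Qed.
HB.instance Definition _ := GRing.isMonoidMorphism.Build _ _ free_eval
  free_eval_monoid.

Lemma free_eval_scalable : scalable free_eval.
Proof. by move=> c p; rewrite /free_eval mmapZ /= mulr_algl. Qed.
HB.instance Definition _ := GRing.isScalable.Build k _ _ _ free_eval
  free_eval_scalable.

Lemma free_eval_gen x : free_eval (fgen x) = f x.
Proof. by rewrite /free_eval mmapU /= scale1r mul1r /fword fmU big_seq1. Qed.

Lemma free_eval_unique (g : {lrmorphism freeAlg -> A}) :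
  (forall x, g (fgen x) = f x) -> g =1 free_eval.
Proof.
move=> gf p; rewrite [p]monalgE !raddf_sum; apply: eq_bigr => m _.
have -> : << p@_m *g m >> = p@_m *: (<< m >> : freeAlg).
  by apply/malgP => n; rewrite mcoeffZ !mcoeffU mulrnAr mulr1.
apply: etrans (linearZ_LR g _ _) _.
apply: etrans (esym (linearZ_LR free_eval _ _)); congr (_ *: _).
case: m => m; elim: m => [|x m IH].
  by rewrite -fmoneE -[<< _ >>]/(1 : freeAlg) !rmorph1.
have -> : << FMonom (x :: m) >> = fgen x * << FMonom m >> :> freeAlg.
  by rewrite /fgen malgM_def fgmulUU mulr1 /mmul /= fmmulE fmuE.
by rewrite !rmorphM /= IH gf free_eval_gen.
Qed.

End Eval.
End FreeAlgebra.

Section EnvelopingAlgebra.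
Variables (k : fieldType) (L : lieAlgType k).

(* U(L) is the free algebra on the underlying set of L modulo linearity of the
   inclusion of L (the quotient by these relations being the tensor algebra of
   L) and x y - y x = [x, y]. Its universal property is given by env_iota_lie,
   env_lift_iota and env_lift_unique below. *)
Inductive env_rel : set (freeAlg k L) :=
| env_rel_linear c x y :
    env_rel (fgen k (c *: x + y) - (c *: fgen k x + fgen k y))
| env_rel_lie x y :
    env_rel (fgen k x * fgen k y - fgen k y * fgen k x - fgen k (lie x y)).

Definition env_ideal : pred (freeAlg k L) :=
  fun p => `[< ideal_gen setT env_rel p >].

Lemma env_ideal_gen p : p \in env_ideal <-> ideal_gen setT env_rel p.
Proof. by split=> /asboolP. Qed.

Lemma env_idealM u v x : x \in env_ideal -> u * x * v \in env_ideal.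
Proof. by rewrite !env_ideal_gen; apply: ideal_gen_mul. Qed.

Lemma env_ideal_zmod : zmod_closed env_ideal.
Proof.
split=> [|x y]; rewrite !env_ideal_gen; first exact: ideal_gen0.
move=> Ix Iy; apply: ideal_gen_add => //.
have := @ideal_gen_mul _ _ _ (-1) 1 _ _ I I Iy.
by rewrite mulr1 mulN1r; apply.
Qed.
HB.instance Definition _ := GRing.isZmodClosed.Build _ env_ideal env_ideal_zmod.

Lemma env_ideal_eval (A : algType k) (f : L -> A) :
  linear f -> (forall x y, f (lie x y) = f x * f y - f y * f x) ->
  forall p, p \in env_ideal -> free_eval f p = 0.
Proof.
move=> flin flie p; rewrite env_ideal_gen.
elim=> [|u s v x _ Ss _ _ IH]; first exact: rmorph0.
rewrite rmorphD /= IH addr0 2!rmorphM /=.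
suff -> : free_eval f s = 0 by rewrite mulr0 mul0r.
case: Ss => [c y z|y z].
  by rewrite rmorphB rmorphD /= linearZ /= 3!free_eval_gen flin subrr.
rewrite rmorphB rmorph_commutator /= (free_eval_gen f y) (free_eval_gen f z).
by rewrite free_eval_gen flie subrr.
Qed.

Lemma env_ideal1 : 1 \notin env_ideal.
Proof.
apply/negP => /(@env_ideal_eval k^o (fun=> 0)) H.
have /eqP : (1 : k) = 0.
  rewrite -[RHS]H ?rmorph1 // => [c x y|x y]; last by rewrite !mulr0 subrr.
  by rewrite scaler0 addr0.
by rewrite oner_eq0.
Qed.

Definition envAlg :=
  Quotient.quot (GRing.ZmodClosed.clone (freeAlg k L) env_ideal _).
HB.instance Definition _ := GRing.Zmodule.on envAlg.
HB.instance Definition _ := Quotient.on envAlg.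

Local Notation pi := (\pi_envAlg).

Lemma env_piP p q : reflect (pi p = pi q) (p - q \in env_ideal).
Proof. by rewrite Quotient.idealrBE; apply: eqP. Qed.

Lemma env_piD p q : pi (p + q) = pi p + pi q.
Proof. by rewrite !piE. Qed.

Definition env_one : envAlg := pi 1.
Definition env_mul (x y : envAlg) : envAlg := pi (repr x * repr y).
Definition env_scale c (x : envAlg) : envAlg := pi (c *: repr x).

Lemma env_mulE p q : env_mul (pi p) (pi q) = pi (p * q).
Proof.
apply/env_piP.
set p' := repr _; set q' := repr _.
have Ip : p' - p \in env_ideal by apply/env_piP; rewrite reprK.
have Iq : q' - q \in env_ideal by apply/env_piP; rewrite reprK.
have -> : p' * q' - p * q = 1 * (p' - p) * q' + p * (q' - q) * 1.
  by rewrite mul1r mulr1 mulrBl mulrBr addrA subrK.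
by apply: rpredD; apply: env_idealM.
Qed.

Lemma env_scaleE c p : env_scale c (pi p) = pi (c *: p).
Proof.
apply/env_piP; set p' := repr _.
have Ip : p' - p \in env_ideal by apply/env_piP; rewrite reprK.
rewrite -scalerBr -[_ - _]mulr1 scalerAl -mulr_algl; exact: env_idealM.
Qed.

Let piP (x : envAlg) : exists p, x = pi p.
Proof. by exists (repr x); rewrite reprK. Qed.

Fact env_mulA : associative env_mul.
Proof.
move=> x y z; have [[[p ->] [q ->]] [r ->]] := (piP x, piP y, piP z).
by rewrite !env_mulE mulrA.
Qed.
Fact env_mul1r : left_id env_one env_mul.
Proof. by move=> x; have [p ->] := piP x; rewrite env_mulE mul1r. Qed.
Fact env_mulr1 : right_id env_one env_mul.
Proof. by move=> x; have [p ->] := piP x; rewrite env_mulE mulr1. Qed.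
Fact env_mulrDl : left_distributive env_mul +%R.
Proof.
move=> x y z; have [[[p ->] [q ->]] [r ->]] := (piP x, piP y, piP z).
by rewrite -env_piD !env_mulE -env_piD mulrDl.
Qed.
Fact env_mulrDr : right_distributive env_mul +%R.
Proof.
move=> x y z; have [[[p ->] [q ->]] [r ->]] := (piP x, piP y, piP z).
by rewrite -env_piD !env_mulE -env_piD mulrDr.
Qed.
Fact env_oner_neq0 : env_one != 0.
Proof.
have -> : 0 = pi 0 by rewrite !piE.
by apply/eqP => /env_piP; rewrite subr0 (negPf env_ideal1).
Qed.
HB.instance Definition _ := GRing.Zmodule_isNzRing.Build envAlg
  env_mulA env_mul1r env_mulr1 env_mulrDl env_mulrDr env_oner_neq0.

Fact env_scalerA a b x : env_scale a (env_scale b x) = env_scale (a * b) x.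
Proof. by have [p ->] := piP x; rewrite !env_scaleE scalerA. Qed.
Fact env_scale1r : left_id 1 env_scale.
Proof. by move=> x; have [p ->] := piP x; rewrite env_scaleE scale1r. Qed.
Fact env_scalerDr : right_distributive env_scale +%R.
Proof.
move=> a x y; have [[p ->] [q ->]] := (piP x, piP y).
by rewrite -env_piD !env_scaleE -env_piD scalerDr.
Qed.
Fact env_scalerDl x : {morph env_scale^~ x : a b / a + b}.
Proof.
by move=> a b; have [p ->] := piP x; rewrite !env_scaleE -env_piD scalerDl.
Qed.
HB.instance Definition _ := GRing.Zmodule_isLmodule.Build k envAlg
  env_scalerA env_scale1r env_scalerDr env_scalerDl.

Fact env_scalerAl a (x y : envAlg) : a *: (x * y) = (a *: x) * y.
Proof.
have [[p ->] [q ->]] := (piP x, piP y).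
by rewrite -[LHS]/(env_scale a (env_mul _ _)) -[RHS]/(env_mul (env_scale a _) _)
  !(env_scaleE, env_mulE) scalerAl.
Qed.
HB.instance Definition _ := GRing.Lmodule_isLalgebra.Build k envAlg env_scalerAl.
Fact env_scalerAr a (x y : envAlg) : a *: (x * y) = x * (a *: y).
Proof.
have [[p ->] [q ->]] := (piP x, piP y).
by rewrite -[LHS]/(env_scale a (env_mul _ _)) -[RHS]/(env_mul _ (env_scale a _))
  !(env_scaleE, env_mulE) scalerAr.
Qed.
HB.instance Definition _ := GRing.Lalgebra_isAlgebra.Build k envAlg env_scalerAr.

Definition env_iota (x : L) : envAlg := pi (fgen k x).

Lemma env_iota_linear : linear env_iota.
Proof.
move=> c x y; rewrite /env_iota.
rewrite -[c *: pi _]/(env_scale c (pi _)) env_scaleE -env_piD.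
apply/env_piP/env_ideal_gen.
rewrite -[_ - _]addr0 -[_ - _]mulr1 -[_ - _]mul1r.
by apply: ideal_genD => //; [apply: env_rel_linear | apply: ideal_gen0].
Qed.
HB.instance Definition _ := GRing.isLinear.Build k L envAlg _ env_iota
  env_iota_linear.

Lemma env_iota_lie x y :
  env_iota (lie x y) = env_iota x * env_iota y - env_iota y * env_iota x.
Proof.
apply/esym/eqP; rewrite -subr_eq0; apply/eqP.
rewrite /env_iota -![pi _ * _]/(env_mul _ _) !env_mulE -!raddfB /=.
rewrite -[RHS](raddf0 pi); apply/env_piP/env_ideal_gen.
rewrite subr0 -[_ - _]addr0 -[_ - _]mulr1 -[_ - _]mul1r.
by apply: ideal_genD => //; [apply: env_rel_lie | apply: ideal_gen0].
Qed.

Section Lift.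
Variables (A : algType k) (f : L -> A).
Hypothesis f_linear : linear f.
Hypothesis f_lie : forall x y, f (lie x y) = f x * f y - f y * f x.

Definition env_lift (x : envAlg) : A := free_eval f (repr x).

Lemma env_liftE p : env_lift (pi p) = free_eval f p.
Proof.
apply/eqP; rewrite -subr_eq0 -rmorphB; apply/eqP/env_ideal_eval => //.
by apply/env_piP; rewrite reprK.
Qed.

Lemma env_lift_linear : linear env_lift.
Proof.
move=> c x y; have [[p ->] [q ->]] := (piP x, piP y).
rewrite -[c *: pi p]/(env_scale c (pi p)) env_scaleE -env_piD !env_liftE.
exact: linearP.
Qed.

Lemma env_lift_monoid : monoid_morphism env_lift.
Proof.
split=> [|x y]; first by rewrite -[1]/(pi 1) env_liftE rmorph1.
have [[p ->] [q ->]] := (piP x, piP y).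
by rewrite -[pi p * pi q]/(env_mul (pi p) (pi q)) env_mulE !env_liftE rmorphM.
Qed.

Lemma env_lift_iota x : env_lift (env_iota x) = f x.
Proof. by rewrite env_liftE free_eval_gen. Qed.

End Lift.

Lemma env_lift_unique (A : algType k) (g : {lrmorphism envAlg -> A}) :
  g =1 env_lift (g \o env_iota).
Proof.
have glin : linear (g \o env_iota) by move=> c x y /=; rewrite !linearP.
have glie x y : (g \o env_iota) (lie x y) =
    (g \o env_iota) x * (g \o env_iota) y - (g \o env_iota) y * (g \o env_iota) x.
  rewrite /= env_iota_lie; exact: rmorph_commutator.
pose h p : A := g (pi p).
have h_linear : linear h.
  move=> c p q; rewrite /h env_piD -env_scaleE.
  by rewrite -[env_scale c (pi p)]/(c *: pi p) linearP.
have h_monoid : monoid_morphism h.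
  by split=> [|p q]; rewrite /h -?env_mulE ?(rmorph1 g) ?(rmorphM g).
pose hl := GRing.isLinear.Build _ _ _ _ h h_linear.
pose hm := GRing.isMonoidMorphism.Build _ _ h h_monoid.
pose H : {lrmorphism freeAlg k L -> A} := HB.pack h hl hm.
move=> x; have [p ->] := piP x; rewrite env_liftE //.
exact: (free_eval_unique (g := H)).
Qed.

End EnvelopingAlgebra.

Section OppositeAlgebra.
Variables (k : fieldType) (A : algType k).

(* R^c is R with reversed multiplication: algebra morphisms into opp_alg are
   algebra anti-homomorphisms into A. *)
Definition opp_alg := A^c.
HB.instance Definition _ := GRing.NzRing.on opp_alg.

Definition opp_scale (c : k) (x : opp_alg) : opp_alg := c *: (x : A).

Fact opp_scalerA a b x : opp_scale a (opp_scale b x) = opp_scale (a * b) x.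
Proof. exact: scalerA. Qed.
Fact opp_scale1r : left_id 1 opp_scale.
Proof. exact: scale1r. Qed.
Fact opp_scalerDr : right_distributive opp_scale +%R.
Proof. exact: scalerDr. Qed.
Fact opp_scalerDl x : {morph opp_scale^~ x : a b / a + b}.
Proof. by move=> a b; exact: scalerDl. Qed.
HB.instance Definition _ := GRing.Zmodule_isLmodule.Build k opp_alg
  opp_scalerA opp_scale1r opp_scalerDr opp_scalerDl.

Fact opp_scalerAl c (x y : opp_alg) : c *: (x * y) = (c *: x) * y.
Proof. exact: (scalerAr c (y : A) (x : A)). Qed.
HB.instance Definition _ := GRing.Lmodule_isLalgebra.Build k opp_alg opp_scalerAl.
Fact opp_scalerAr c (x y : opp_alg) : c *: (x * y) = x * (c *: y).
Proof. exact: (scalerAl c (y : A) (x : A)). Qed.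
HB.instance Definition _ := GRing.Lalgebra_isAlgebra.Build k opp_alg opp_scalerAr.

End OppositeAlgebra.

Section FiniteSupportSums.
Variables (K : choiceType) (G V : zmodType) (F : K -> G -> V).

(* The additive map sending << c *g x >> to F x c. *)
Definition msum (g : {malg G[K]}) : V := \sum_(x <- msupp g) F x g@_x.

Hypothesis F_additive : forall x, zmod_morphism (F x).

Let F0 x : F x 0 = 0.
Proof. by rewrite -[X in F x X](subrr 0) F_additive subrr. Qed.

Lemma msumEw (d : {fset K}) g : (msupp g `<=` d)%fset ->
  msum g = \sum_(x <- d) F x g@_x.
Proof.
by move=> le; rewrite [LHS](big_fset_incl _ le) => //= x _ /mcoeff_outdom ->.
Qed.

Lemma msum_additive : zmod_morphism msum.
Proof.
move=> g h; set d := (msupp g `|` msupp h)%fset.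
rewrite (@msumEw d (g - h)) ?msuppB_le // (@msumEw d g) ?fsubsetUl //.
rewrite (@msumEw d h) ?fsubsetUr // -sumrB.
by apply: eq_bigr => x _; rewrite mcoeffB F_additive.
Qed.

Lemma msumU c x : msum << c *g x >> = F x c.
Proof. by rewrite (msumEw msuppU_le) big_seq_fset1 mcoeffUU. Qed.

End FiniteSupportSums.

Lemma msum_linear (K : choiceType) (R : nzRingType) (V : lmodType R)
    (F : K -> R -> V) :
  (forall x c y z, F x (c * y + z) = c *: F x y + F x z) -> linear (msum F).
Proof.
move=> FP.
have F_additive x : zmod_morphism (F x).
  by move=> y z; rewrite -[y - z]addrC -mulN1r FP scaleN1r addrC.
have [F0 FZ] : (forall x, F x 0 = 0) /\ (forall x c y, F x (c * y) = c *: F x y).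
  have F0 x : F x 0 = 0 by rewrite -[X in F x X](subrr 0) F_additive subrr.
  by split=> // x c y; rewrite -[X in F x X]addr0 FP F0 addr0.
move=> c g h; rewrite -[h in LHS]opprK msum_additive //.
rewrite -[- h]sub0r msum_additive // /msum msupp0 big_seq_fset0 sub0r opprK.
congr (_ + _); rewrite -[LHS]/(msum F _) (msumEw _ (msuppZ_le c g)) //.
by rewrite scaler_sumr; apply: eq_bigr => x _; rewrite mcoeffZ FZ.
Qed.

Lemma malg_ind (K : choiceType) (G : zmodType) (P : {malg G[K]} -> Prop) :
  P 0 -> (forall g h, P g -> P h -> P (g + h)) ->
  (forall c x, P << c *g x >>) -> forall g, P g.
Proof. by move=> P0 PD PU g; rewrite [g]monalgE; apply: big_ind. Qed.

Lemma malgZU (K : choiceType) (R : nzRingType) (c x : R) (i : K) :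
  c *: << x *g i >> = << c * x *g i >>.
Proof. by apply/malgP => j; rewrite mcoeffZ !mcoeffU mulrnAr. Qed.

Section BiadditiveOperations.
Variables (K : choiceType) (G : zmodType).
Local Notation V := {malg G[K]}.
Variable op : V -> V -> V.
Hypothesis opDl : forall u v w, op (u + v) w = op u w + op v w.
Hypothesis opDr : forall u v w, op w (u + v) = op w u + op w v.

Lemma biadd0l w : op 0 w = 0.
Proof. by apply: (addrI (op 0 w)); rewrite -opDl !addr0. Qed.
Lemma biadd0r w : op w 0 = 0.
Proof. by apply: (addrI (op w 0)); rewrite -opDr !addr0. Qed.

Variables (f : G -> K -> G -> K -> G) (h : K -> K -> K).
Hypothesis opU : forall a i b j,
  op << a *g i >> << b *g j >> = << f a i b j *g h i j >>.

Lemma biadd_anti :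
  (forall a i b j, << f a i b j *g h i j >> + << f b j a i *g h j i >> = 0 :> V) ->
  forall u v, op u v + op v u = 0.
Proof.
move=> fh u v; elim/malg_ind: u => [|u w hu hw|x mu].
- by rewrite biadd0l biadd0r addr0.
- by rewrite opDl opDr addrACA hu hw addr0.
elim/malg_ind: v => [|u w hu hw|y nu].
- by rewrite biadd0l biadd0r addr0.
- by rewrite opDl opDr addrACA hu hw addr0.
by rewrite !opU.
Qed.

Lemma biadd_alt : (forall u v, op u v + op v u = 0) ->
  (forall a i, f a i a i = 0) -> forall u, op u u = 0.
Proof.
move=> anti fh u; elim/malg_ind: u => [|u w hu hw|a i].
- by rewrite biadd0l.
- by rewrite opDl !opDr hu hw add0r addr0 anti.
by rewrite opU fh monalgU0.
Qed.

Let jac u v w := op u (op v w) + op v (op w u) + op w (op u v).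

Let jacD u u' v w : jac (u + u') v w = jac u v w + jac u' v w.
Proof. by rewrite /jac !(opDl, opDr) (addrACA (op u (op v w)))
  (addrACA (op u (op v w) + op v (op w u))). Qed.
Let jac0 v w : jac 0 v w = 0.
Proof. by rewrite /jac !(biadd0l, biadd0r) !addr0. Qed.
Let jacC u v w : jac u v w = jac v w u.
Proof. by rewrite /jac -addrA addrC. Qed.

Lemma biadd_jacobi :
  (forall a i b j c l, << f a i (f b j c l) (h j l) *g h i (h j l) >> +
    << f b j (f c l a i) (h l i) *g h j (h l i) >> +
    << f c l (f a i b j) (h i j) *g h l (h i j) >> = 0 :> V) ->
  forall u v w, op u (op v w) + op v (op w u) + op w (op u v) = 0.
Proof.
move=> fh u v w; rewrite -/(jac u v w).
have jacU a i b j c l : jac << a *g i >> << b *g j >> << c *g l >> = 0.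
  by rewrite /jac !opU.
elim/malg_ind: u => [|u w' hu hw|a i]; rewrite ?jac0 ?jacD ?hu ?hw ?addr0 //.
rewrite jacC; elim/malg_ind: v => [|u w' hu hw|b j];
  rewrite ?jac0 ?jacD ?hu ?hw ?addr0 //.
rewrite jacC; elim/malg_ind: w => [|u w' hu hw|c l];
  rewrite ?jac0 ?jacD ?hu ?hw ?addr0 //.
Qed.

Lemma biadd_assoc :
  (forall i j l, h i (h j l) = h (h i j) l) ->
  (forall a i b j c l,
     f a i (f b j c l) (h j l) = f (f a i b j) (h i j) c l) ->
  associative op.
Proof.
move=> hA fA u v w.
elim/malg_ind: u => [|u u' hu hu'|a i].
- by rewrite !biadd0l.
- by rewrite !opDl hu hu'.
elim/malg_ind: v => [|u u' hu hu'|b j].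
- by rewrite !(biadd0l, biadd0r).
- by rewrite !(opDl, opDr) hu hu'.
elim/malg_ind: w => [|u u' hu hu'|c l].
- by rewrite !biadd0r.
- by rewrite !opDr hu hu'.
by rewrite !opU hA fA.
Qed.

Lemma biadd_left_id e o : (forall i, h o i = i) ->
  (forall a i, f e o a i = a) -> left_id << e *g o >> op.
Proof.
move=> ho fe u; elim/malg_ind: u => [|u u' hu hu'|a i].
- by rewrite biadd0r.
- by rewrite opDr hu hu'.
- by rewrite opU ho fe.
Qed.

Lemma biadd_right_id e o : (forall i, h i o = i) ->
  (forall a i, f a i e o = a) -> right_id << e *g o >> op.
Proof.
move=> ho fe u; elim/malg_ind: u => [|u u' hu hu'|a i].
- by rewrite biadd0l.
- by rewrite opDl hu hu'.
- by rewrite opU ho fe.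
Qed.

End BiadditiveOperations.

Lemma additive_malg_eq (K : choiceType) (G V : zmodType)
    (f g : {malg G[K]} -> V) :
  zmod_morphism f -> zmod_morphism g ->
  (forall a i, f << a *g i >> = g << a *g i >>) -> f =1 g.
Proof.
move=> fB gB fg u.
pose fm := GRing.isZmodMorphism.Build _ _ f fB.
pose gm := GRing.isZmodMorphism.Build _ _ g gB.
pose f' : {additive {malg G[K]} -> V} := HB.pack f fm.
pose g' : {additive {malg G[K]} -> V} := HB.pack g gm.
rewrite -[LHS]/(f' u) -[RHS]/(g' u) [u]monalgE !raddf_sum /=.
by apply: eq_bigr => i _; exact: fg.
Qed.

Lemma zmod_morphismD (U V : zmodType) (f : U -> V) :
  zmod_morphism f -> {morph f : x y / x + y}.
Proof.
move=> fB x y; have f0 : f 0 = 0 by rewrite -(subrr 0) fB subrr.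
by rewrite -[y in LHS]opprK fB -[- y]sub0r fB f0 sub0r opprK.
Qed.

Lemma linear_zmod (R : nzRingType) (U V : lmodType R) (f : U -> V) :
  linear f -> zmod_morphism f.
Proof.
by move=> fL x y; rewrite -[x - y]addrC -scaleN1r fL scaleN1r addrC.
Qed.

Lemma malg_commutator_morphism (K : choiceType) (G : zmodType) (A : nzRingType)
    (br : {malg G[K]} -> {malg G[K]} -> {malg G[K]}) (f : {malg G[K]} -> A) :
  (forall w, zmod_morphism (br^~ w)) -> (forall w, zmod_morphism (br w)) ->
  zmod_morphism f ->
  (forall a i b j, f (br << a *g i >> << b *g j >>) =
    f << a *g i >> * f << b *g j >> - f << b *g j >> * f << a *g i >>) ->
  forall u v, f (br u v) = f u * f v - f v * f u.
Proof.
move=> brl brr fB fU u v.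
move: u; apply: additive_malg_eq => [x y|x y|a i].
- by rewrite brl fB.
- by rewrite fB mulrBl mulrBr !opprB addrACA [RHS]addrACA (addrC (- _)).
move: v; apply: additive_malg_eq => [x y|x y|b j //].
- by rewrite brr fB.
- by rewrite fB mulrBl mulrBr !opprB addrACA [RHS]addrACA (addrC (- _)).
Qed.

Section SubgroupType.
Variables (V : zmodType) (G : zmodClosed V).

Record subgroup_type : predArgType :=
  Subgroup_type { sub_val : V; _ : sub_val \in G }.

HB.instance Definition _ := [isSub for sub_val].
HB.instance Definition _ := [Choice of subgroup_type by <:].
HB.instance Definition _ := [SubChoice_isSubZmodule of subgroup_type by <:].

End SubgroupType.

Definition fg_subgroup (V : zmodType) (G : zmodClosed V) : Prop :=
  exists (n : nat) (g : 'I_n -> V), forall x,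
    x \in G <-> exists m : 'I_n -> int, x = \sum_(i < n) g i *~ m i.

Fact scaler_comb (R : comNzRingType) (V : lmodType R) (w a x y d : R) (e : V) :
  (w * (a * x + y) * d) *: e = a *: ((w * x * d) *: e) + (w * y * d) *: e.
Proof.
by rewrite scalerA -scalerDl mulrDr mulrDl (mulrCA w) -(mulrA a).
Qed.

Section WittAlgebra.
Variables (k : fieldType) (G : zmodClosed k).

Local Notation Gam := (subgroup_type G).

(* witt_lie is the bilinear extension of [e_mu, e_nu] = (nu - mu) e_(nu + mu);
   see witt_lie_e. *)
Definition witt := {malg k[Gam]}.
HB.instance Definition _ := GRing.Lmodule.on witt.

Definition witt_e (nu : Gam) : witt := << nu >>.

Definition witt_lie (u v : witt) : witt :=
  msum (fun mu x => msum (fun nu y =>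
    (x * y * (val nu - val mu)) *: witt_e (nu + mu)) v) u.

Let witt_eZ c (g : Gam) : c *: witt_e g = << c *g g >>.
Proof. by rewrite -[c in RHS]mulr1; exact: malgZU. Qed.

Lemma witt_lieU x mu y nu :
  witt_lie << x *g mu >> << y *g nu >> =
  << x * y * (val nu - val mu) *g nu + mu >>.
Proof.
rewrite -[RHS]witt_eZ /witt_lie msumU; last first.
  by move=> ka a b; rewrite /msum -sumrB; apply: eq_bigr => la _;
     rewrite -scalerBl -mulrBl -mulrBl.
by rewrite msumU // => la a b; rewrite -scalerBl -mulrBl -mulrBr.
Qed.

Lemma witt_lie_e mu nu :
  witt_lie (witt_e mu) (witt_e nu) = (val nu - val mu) *: witt_e (nu + mu).
Proof. by rewrite witt_lieU witt_eZ !mul1r. Qed.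

Lemma witt_lie_linearl w : linear (witt_lie^~ w).
Proof.
apply: msum_linear => mu c x y; rewrite /msum scaler_sumr -big_split /=.
by apply: eq_bigr => nu _; rewrite scalerA !mulrA -scalerDl -!mulrDl.
Qed.

Lemma witt_lie_linearr w : linear (witt_lie w).
Proof.
move=> c u v; have E t : witt_lie w t = \sum_(mu <- msupp w)
    msum (fun nu y => (w@_mu * y * (val nu - val mu)) *: witt_e (nu + mu)) t by [].
rewrite !E scaler_sumr -big_split /=.
apply: eq_bigr => mu _; rewrite msum_linear // => nu a x y.
exact: scaler_comb.
Qed.

Let lieDl u v w : witt_lie (u + v) w = witt_lie u w + witt_lie v w.
Proof. by have := witt_lie_linearl w 1 u v; rewrite !scale1r. Qed.
Let lieDr u v w : witt_lie w (u + v) = witt_lie w u + witt_lie w v.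
Proof. by have := witt_lie_linearr w 1 u v; rewrite !scale1r. Qed.

Lemma witt_lie_alt u : witt_lie u u = 0.
Proof.
apply: (biadd_alt lieDl lieDr witt_lieU) => [{}u v|a i]; last first.
  by rewrite subrr mulr0.
apply: (biadd_anti lieDl lieDr witt_lieU) => a i b j.
rewrite (addrC i) (mulrC b) -monalgUD -mulrDr addrA subrK subrr mulr0.
exact: monalgU0.
Qed.

Lemma witt_jacobi u v w :
  witt_lie u (witt_lie v w) + witt_lie v (witt_lie w u)
  + witt_lie w (witt_lie u v) = 0.
Proof.
apply: (biadd_jacobi lieDl lieDr witt_lieU) => a i b j c l.
have -> : i + l + j = l + j + i by rewrite -addrA addrC.
have -> : j + i + l = l + j + i by rewrite addrC addrA.
rewrite -!monalgUD.
suff -> : a * (b * c * (val l - val j)) * (val (l + j) - val i) +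
  b * (c * a * (val i - val l)) * (val (i + l) - val j) +
  c * (a * b * (val j - val i)) * (val (j + i) - val l) = 0 by exact: monalgU0.
rewrite !raddfD /=; move: (sub_val i) (sub_val j) (sub_val l) => x y z.
by ring.
Qed.

HB.instance Definition _ := Lmodule_isLie.Build k witt
  witt_lie_linearl witt_lie_linearr witt_lie_alt witt_jacobi.

End WittAlgebra.

Section SkewGroupAlgebra.
Variables (k : fieldType) (G : zmodClosed k).

Local Notation Gam := (subgroup_type G).
Local Notation kab := {poly {poly k}}.

(* k[a,b] is encoded as k[b][a]: a is the outer variable 'X and b is 'X%:P, so
   that shift c p is p(a + c, b). *)
Definition shift (c : k) (p : kab) : kab := p \Po ('X + c%:P%:P).

Lemma shift_additive c : zmod_morphism (shift c).
Proof. by move=> p q; rewrite /shift raddfB. Qed.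
Lemma shiftM c p q : shift c (p * q) = shift c p * shift c q.
Proof. by rewrite /shift rmorphM. Qed.
Lemma shift1 c : shift c 1 = 1.
Proof. by rewrite /shift rmorph1. Qed.
Lemma shiftC c (b : {poly k}) : shift c b%:P = b%:P.
Proof. by rewrite /shift comp_polyC. Qed.
Lemma shiftX c : shift c 'X = 'X + c%:P%:P.
Proof. by rewrite /shift comp_polyX. Qed.
Lemma shift0 p : shift 0 p = p.
Proof. by rewrite /shift !polyC0 addr0 comp_polyXr. Qed.
Lemma shiftD c d p : shift (c + d) p = shift c (shift d p).
Proof.
rewrite /shift -comp_polyA; congr (_ \Po _).
by rewrite comp_polyD comp_polyX comp_polyC !polyCD addrA.
Qed.

Definition skew_alg := {malg kab[Gam]}.
HB.instance Definition _ := GRing.Zmodule.on skew_alg.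

(* skew_mono p g is p t^g, and the product is the biadditive extension of
   (p t^g) (q t^d) = p q(a + g, b) t^(g + d). *)
Definition skew_mono (p : kab) (g : Gam) : skew_alg := << p *g g >>.

Definition skew_one : skew_alg := skew_mono 1 0.
Definition skew_mul (u v : skew_alg) : skew_alg :=
  msum (fun g p => msum (fun d q =>
    skew_mono (p * shift (val g) q) (g + d)) v) u.
Definition skew_scale (c : k) (u : skew_alg) : skew_alg :=
  (c%:P%:P : kab) *: (u : {malg kab[Gam]}).

Let monoB g : zmod_morphism (skew_mono^~ g).
Proof. by move=> p q; exact: monalgUB. Qed.

Lemma skew_mulU p g q d : skew_mul (skew_mono p g) (skew_mono q d) =
  skew_mono (p * shift (val g) q) (g + d).
Proof.
rewrite /skew_mul msumU; last first.
  by move=> h a b; rewrite /msum -sumrB; apply: eq_bigr => l _;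
     rewrite mulrBl monoB.
by rewrite msumU; last by move=> l a b; rewrite shift_additive mulrBr monoB.
Qed.

Let skew_mulBl w : zmod_morphism (skew_mul^~ w).
Proof.
apply: msum_additive => g a b; rewrite /msum -sumrB.
by apply: eq_bigr => d _; rewrite mulrBl monoB.
Qed.
Let skew_mulBr w : zmod_morphism (skew_mul w).
Proof.
move=> u v; have E t : skew_mul w t = \sum_(g <- msupp w) msum (fun d q =>
    skew_mono (w@_g * shift (val g) q) (g + d)) t by [].
rewrite !E -sumrB; apply: eq_bigr => g _.
by rewrite msum_additive; last by move=> d a b; rewrite shift_additive mulrBr monoB.
Qed.

Fact skew_mulDl : left_distributive skew_mul +%R.
Proof. by move=> u v w; exact: (zmod_morphismD (skew_mulBl w)). Qed.
Fact skew_mulDr : right_distributive skew_mul +%R.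
Proof. by move=> w u v; exact: (zmod_morphismD (skew_mulBr w)). Qed.

Let mulsDr u v w : skew_mul w (u + v) = skew_mul w u + skew_mul w v.
Proof. exact: skew_mulDr. Qed.

Fact skew_mulA : associative skew_mul.
Proof.
apply: (biadd_assoc skew_mulDl mulsDr (fun p g q d => skew_mulU p g q d)).
  exact: addrA.
by move=> p g q d r e; rewrite shiftM -shiftD mulrA.
Qed.
Fact skew_mul1 : left_id skew_one skew_mul.
Proof.
apply: (biadd_left_id mulsDr (fun p g q d => skew_mulU p g q d)) => [|p g].
  exact: add0r.
by rewrite shift0 mul1r.
Qed.
Fact skew_mulr1 : right_id skew_one skew_mul.
Proof.
apply: (biadd_right_id skew_mulDl (fun p g q d => skew_mulU p g q d)) => [|p g].
  exact: addr0.
by rewrite shift1 mulr1.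
Qed.
Fact skew_oner_neq0 : skew_one != 0.
Proof. by rewrite monalgU_eq0 oner_eq0. Qed.
HB.instance Definition _ := GRing.Zmodule_isNzRing.Build skew_alg
  skew_mulA skew_mul1 skew_mulr1 skew_mulDl skew_mulDr skew_oner_neq0.

Fact skew_scalerA a b u : skew_scale a (skew_scale b u) = skew_scale (a * b) u.
Proof. by rewrite /skew_scale scalerA -!polyCM. Qed.
Fact skew_scale1r : left_id 1 skew_scale.
Proof. by move=> u; rewrite /skew_scale !polyC1 scale1r. Qed.
Fact skew_scalerDr : right_distributive skew_scale +%R.
Proof. by move=> c u v; exact: scalerDr. Qed.
Fact skew_scalerDl u : {morph skew_scale^~ u : a b / a + b}.
Proof. by move=> a b; rewrite /skew_scale !polyCD; exact: scalerDl. Qed.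
HB.instance Definition _ := GRing.Zmodule_isLmodule.Build k skew_alg
  skew_scalerA skew_scale1r skew_scalerDr skew_scalerDl.

Lemma skewZU c p g : c *: skew_mono p g = skew_mono (c%:P%:P * p) g.
Proof. exact: malgZU. Qed.

Lemma skewM p g q d : skew_mono p g * skew_mono q d =
  skew_mono (p * shift (val g) q) (g + d).
Proof. exact: skew_mulU. Qed.

Lemma skew_scaleE c (u : skew_alg) : c *: u = skew_mono c%:P%:P 0 * u.
Proof.
apply: (additive_malg_eq (f := fun u : skew_alg => c *: u)
  (g := fun u : skew_alg => skew_mono c%:P%:P 0 * u)) => [v w|v w|p g].
- exact: scalerBr.
- exact: mulrBr.
by rewrite -/(skew_mono p g) skewZU skewM shift0 add0r.
Qed.

Lemma skew_scaler_comm c (u : skew_alg) :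
  skew_mono c%:P%:P 0 * u = u * skew_mono c%:P%:P 0.
Proof.
apply: (additive_malg_eq (f := fun u : skew_alg => skew_mono c%:P%:P 0 * u)
  (g := fun u : skew_alg => u * skew_mono c%:P%:P 0)) => [v w|v w|p g].
- exact: mulrBr.
- exact: mulrBl.
rewrite -/(skew_mono p g) (skewM c%:P%:P 0) (skewM p g).
by rewrite shift0 shiftC add0r addr0 mulrC.
Qed.

Fact skew_scalerAl c (u v : skew_alg) : c *: (u * v) = (c *: u) * v.
Proof. by rewrite !skew_scaleE mulrA. Qed.
HB.instance Definition _ := GRing.Lmodule_isLalgebra.Build k skew_alg skew_scalerAl.
Fact skew_scalerAr c (u v : skew_alg) : c *: (u * v) = u * (c *: v).
Proof. by rewrite !skew_scaleE mulrA skew_scaler_comm mulrA. Qed.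
HB.instance Definition _ := GRing.Lalgebra_isAlgebra.Build k skew_alg skew_scalerAr.

End SkewGroupAlgebra.

Lemma opp_algM (k : fieldType) (A : algType k) (x y : opp_alg A) :
  x * y = (y : A) * (x : A) :> A.
Proof. by []. Qed.

Lemma opp_alg_commutator (k : fieldType) (A : algType k) a b (x y : opp_alg A) :
  (a *: x) * (b *: y) - (b *: y) * (a *: x) =
  (a * b) *: ((y : A) * (x : A) - (x : A) * (y : A)).
Proof.
by rewrite -!scalerAl -!scalerAr !scalerA (mulrC b) -scalerBr.
Qed.

Section Phi.
Variables (k : fieldType) (G : zmodClosed k).

Local Notation Gam := (subgroup_type G).
Local Notation W := (witt G).
Local Notation U := (envAlg W).
Local Notation T := (skew_alg G).

Definition phi_e (nu : Gam) : T :=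
  skew_mono ('X + 'X%:P * (val nu)%:P%:P) nu.

Definition phi (u : W) : opp_alg T := msum (fun nu x => x *: phi_e nu) u.

Lemma phi_linear : linear phi.
Proof. by apply: msum_linear => nu c y z; rewrite scalerDl scalerA. Qed.

Lemma phiU c nu : phi << c *g nu >> = c *: phi_e nu.
Proof. by rewrite /phi msumU; last by move=> g a b; rewrite scalerBl. Qed.

Lemma phi_e_lie mu nu : phi_e nu * phi_e mu - phi_e mu * phi_e nu =
  (val nu - val mu) *: phi_e (nu + mu).
Proof.
rewrite !skewM skewZU [mu + nu]addrC.
apply: etrans (esym (monalgUB _ _ _)) _; congr (<< _ *g _ >>).
rewrite ![shift _ (_ + _)]comp_polyD -!/(shift _ _) !shiftM !shiftX !shiftC.
rewrite !raddfB !raddfD /=; ring.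
Qed.

Lemma phi_lie u v : phi (lie u v) = phi u * phi v - phi v * phi u.
Proof.
apply: (malg_commutator_morphism (br := @witt_lie k G) (f := phi)).
- by move=> w; exact: linear_zmod (witt_lie_linearl w).
- by move=> w; exact: linear_zmod (witt_lie_linearr w).
- exact: linear_zmod phi_linear.
move=> a i b j; rewrite witt_lieU.
apply: etrans (phiU (a * b * (val j - val i)) (j + i)) _.
rewrite (phiU a i) (phiU b j).
rewrite opp_alg_commutator.
rewrite phi_e_lie.
exact: esym (scalerA _ _ _).
Qed.

Definition env_Phi (x : U) : T := env_lift phi x.

Definition env_e (nu : Gam) : U := env_iota (witt_e nu).

Lemma env_Phi_linear : linear env_Phi.
Proof. exact: (env_lift_linear phi_linear phi_lie). Qed.

Lemma env_Phi1 : env_Phi 1 = 1.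
Proof. exact: (env_lift_monoid phi_linear phi_lie).1. Qed.

Lemma env_PhiM x y : env_Phi (x * y) = env_Phi y * env_Phi x.
Proof.
apply: etrans ((env_lift_monoid phi_linear phi_lie).2 x y) _.
exact (opp_algM (A := T) (env_Phi x) (env_Phi y)).
Qed.

Lemma env_Phi_e nu : env_Phi (env_e nu) = phi_e nu.
Proof.
apply: etrans (env_lift_iota phi_linear phi_lie _) _.
by apply: etrans (phiU _ _) _; apply: scale1r.
Qed.

Definition p_elt (mu : Gam) : U :=
  env_e mu * env_e (mu *+ 3) - env_e (mu *+ 2) ^+ 2 - val mu *: env_e (mu *+ 4).

End Phi.

(* Main.v *)
Require Import Defs.
From HB Require Import structures.
From mathcomp Require Import all_boot all_order all_algebra.
From mathcomp Require Import boolp classical_sets.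
From mathcomp Require Import finmap monalg ring.

Set Implicit Arguments.
Unset Strict Implicit.
Unset Printing Implicit Defensive.

Import GRing.Theory.

Local Open Scope ring_scope.
Local Open Scope classical_set_scope.

(* One computes Phi(p_mu) = mu^2 b (1 - b) t^(4 mu), and b is central in T, so
   I is contained in b (1 - b) T. Commutators with Phi(e_nu) show that I
   contains a nonzero multiple of b (1 - b) t^g for every g in Gamma.
   For y in T with coefficients y_g in k[a,b], left multiplication by
   Phi(e_nu) = (a + b nu) t^nu produces coefficients vanishing at (a,b) = (0,0),
   so B preserves the condition y_g(0,0) = 0 for each g. Hence an element
   b (1 - b) y of a left ideal of B generated by finitely many elements of
   b (1 - b) T has y_g(0,0) = 0 for every g outside the finitely many supports.
   For right ideals one evaluates y_g at (-g,1) instead, because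
   t^d (a + b nu) t^nu = (a + d + b nu) t^(d + nu). *)

(** * Preliminaries on multiples, finite lists and commutators *)

Lemma mulrn_inj_pchar0 (F : fieldType) (x : F) :
  [pchar F] =i pred0 -> x != 0 -> injective (GRing.natmul x).
Proof.
move=> /pcharf0P char0 x0 i j.
wlog le_ij : i j / (i <= j)%N.
  move=> H E; have [/H|/ltnW/H H'] := leqP i j; first exact.
  exact/esym/H'/esym.
move/esym/eqP; rewrite -subr_eq0 -mulrnBr // -mulr_natr mulf_eq0 (negPf x0).
by rewrite char0 subn_eq0 => le_ji; apply/eqP; rewrite eqn_leq le_ij.
Qed.

Lemma injective_fresh (T : eqType) (f : nat -> T) (l : seq T) :
  injective f -> exists i, f i \notin l.
Proof.
(* Pigeonhole: [f] takes one more distinct value on [s] than [l] has entries. *)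
move=> f_inj; set s := [seq f i | i <- iota 0 (size l).+1].
have /allPn [_ /mapP [i _ ->] fi_l] : ~~ all [in l] s; last by exists i.
apply/negP => /allP /uniq_leq_size.
by rewrite map_inj_uniq // iota_uniq size_map size_iota ltnn => /(_ isT).
Qed.

Lemma ideal_gen_commutator (A : nzRingType) (B : set A) (u w : A) :
  B 1 -> B (- 1) -> B u -> ideal_gen B [set w] (u * w - w * u).
Proof.
move=> B1 BN1 Bu.
(* Elements of [ideal_gen] are bare sums of products, so the minus sign has to come from the factor
   - 1 in [B]. *)
have -> : u * w - w * u = u * w * 1 + (- 1 * w * u + 0).
  by rewrite mulr1 addr0 mulN1r mulNr.
by do 2?[apply: ideal_genD => //]; apply: ideal_gen0.
Qed.

Lemma commutator_mul_central (A : nzRingType) (u z m : A) :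
  u * z = z * u -> u * (z * m) - z * m * u = z * (u * m - m * u).
Proof. by move=> uz; rewrite mulrA uz mulrBr !mulrA. Qed.

Section ImageOfPhi.
Variables (k : fieldType) (G : zmodClosed k).
Local Notation Gam := (subgroup_type G).
Local Notation T := (skew_alg G).
Local Notation kab := {poly {poly k}}.

(** * Coefficients of products with a monomial of T *)

Lemma mcoeff_skew_monoM (p : kab) (g h : Gam) (y : T) :
  (skew_mono p g * y)@_h = p * shift (val g) y@_(h - g).
Proof.
apply: (additive_malg_eq (f := fun y : T => (skew_mono p g * y)@_h)
  (g := fun y : T => p * shift (val g) y@_(h - g))) => [u v|u v|q d].
- by rewrite mulrBr mcoeffB.
- by rewrite mcoeffB shift_additive mulrBr.
rewrite -[<< _ *g _ >>]/(skew_mono q d) skewM !mcoeffU.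
rewrite [d == _]eq_sym subr_eq addrC eq_sym.
by case: (_ == _); rewrite ?mulr1n // !mulr0n /shift comp_poly0 mulr0.
Qed.

Lemma mcoeff_mul_skew_mono (p : kab) (g h : Gam) (y : T) :
  (y * skew_mono p g)@_h = y@_(h - g) * shift (val (h - g)) p.
Proof.
apply: (additive_malg_eq (f := fun y : T => (y * skew_mono p g)@_h)
  (g := fun y : T => y@_(h - g) * shift (val (h - g)) p)) => [u v|u v|q d].
- by rewrite mulrBl mcoeffB.
- by rewrite mcoeffB mulrBl.
rewrite -[<< _ *g _ >>]/(skew_mono q d) skewM !mcoeffU.
have -> : (d == h - g) = (d + g == h) by rewrite eq_sym subr_eq eq_sym.
by case: eqP => [<-|_]; rewrite ?addrK ?mulr1n // !mulr0n mul0r.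
Qed.

Lemma shift_linear (c d : k) : shift c ('X + 'X%:P * d%:P%:P) =
  'X + c%:P%:P + 'X%:P * d%:P%:P.
Proof.
by rewrite (zmod_morphismD (shift_additive c)) shiftM !shiftC shiftX.
Qed.

(** * The element b (1 - b), central because it is free of a and hence fixed by all shifts *)

Definition zpoly : kab := 'X%:P * (1 - 'X%:P).
Definition zelt : T := skew_mono zpoly 0.

Lemma zpoly_neq0 : zpoly != 0.
Proof.
rewrite mulf_neq0 ?polyC_eq0 ?polyX_eq0 //.
by rewrite -polyC1 -polyCB polyC_eq0 -opprB oppr_eq0 polyXsubC_eq0.
Qed.

Lemma mcoeff_zeltM (y : T) (g : Gam) : (zelt * y)@_g = zpoly * y@_g.
Proof. by rewrite mcoeff_skew_monoM subr0 shift0. Qed.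

Lemma shift_zpoly (c : k) : shift c zpoly = zpoly.
Proof. by rewrite /zpoly shiftM shift_additive shift1 shiftC. Qed.

Lemma zelt_comm (y : T) : y * zelt = zelt * y.
Proof.
apply: (additive_malg_eq (f := fun y : T => y * zelt)
  (g := fun y : T => zelt * y)) => [u v|u v|p g].
- exact: mulrBl.
- exact: mulrBr.
rewrite -/(skew_mono p g) (skewM p g) (skewM zpoly 0).
by rewrite add0r addr0 shift0 shift_zpoly (mulrC p).
Qed.

(** * Induction over B and vanishing of coefficients at a point *)

Lemma range_Phi_ind (Q : T -> Prop) :
  Q 1 -> (forall u v, Q u -> Q v -> Q (u + v)) ->
  (forall c u, Q u -> Q (c *: u)) -> (forall u v, Q u -> Q v -> Q (u * v)) ->
  (forall nu, Q (phi_e nu)) -> forall u, range (@env_Phi k G) u -> Q u.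
Proof.
move=> Q1 QD QZ QM Qe u [x _ <-].
have Q0 : Q 0 by rewrite -(scale0r (1 : T)); apply: QZ.
have Qphi w : Q (phi w).
  by rewrite /phi /msum; elim/big_ind: _ => // nu _; apply: QZ; apply: Qe.
(* A representative in the free algebra is a combination of words in elements of W, so its image is
   a combination of products of values of [phi]. *)
rewrite /env_Phi /env_lift /free_eval mmapE.
elim/big_ind: _ => // m _; rewrite mulr_algl; apply: QZ; rewrite /fword.
elim/big_ind: _ => [|v w Qv Qw|w _]; [exact: Q1 | | exact: Qphi].
(* The product is taken in the opposite algebra, hence the swapped factors. *)
exact: (QM w v Qw Qv).
Qed.

Definition coeff_at (a0 b0 : k) (g : Gam) (y : T) : k := (y@_g).[a0%:P].[b0].

Lemma coeff_at_eq0 a0 b0 g (y : T) : y@_g = 0 -> coeff_at a0 b0 g y = 0.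
Proof. by rewrite /coeff_at => ->; rewrite !horner0. Qed.

Lemma coeff_atD_eq0 a0 b0 g (y w : T) :
  coeff_at a0 b0 g y = 0 -> coeff_at a0 b0 g w = 0 ->
  coeff_at a0 b0 g (y + w) = 0.
Proof.
move=> y0 w0; rewrite /coeff_at (mcoeffD g y w) hornerD hornerD.
exact: etrans (congr2 +%R y0 w0) (addr0 0).
Qed.

Lemma coeff_atZ_eq0 a0 b0 g c (y : T) :
  coeff_at a0 b0 g y = 0 -> coeff_at a0 b0 g (c *: y) = 0.
Proof.
move=> y0; have E : (c *: y)@_g = c%:P%:P * y@_g by exact: mcoeffZ.
rewrite /coeff_at E hornerM hornerC hornerM hornerC.
exact: etrans (congr1 ( *%R c) y0) (mulr0 c).
Qed.

Lemma phi_e_left_coeff0 (nu g : Gam) (y : T) :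
  coeff_at 0 0 g (phi_e nu * y) = 0.
Proof. by rewrite /coeff_at mcoeff_skew_monoM !hornerE. Qed.

Lemma phi_e_right_coeff0 (nu g : Gam) (y : T) :
  coeff_at (- val g) 1 g (y * phi_e nu) = 0.
Proof.
(* The shifted factor is a + (g - nu) + b nu, which is zero at a = - g, b = 1. *)
rewrite /coeff_at mcoeff_mul_skew_mono (raddfB val) /= shift_linear.
by rewrite !hornerE /=; ring.
Qed.

Lemma range_Phi_left_coeff0 (g : Gam) (u y : T) :
  range (@env_Phi k G) u -> coeff_at 0 0 g y = 0 ->
  coeff_at 0 0 g (u * y) = 0.
Proof.
move=> Bu; move: y; elim/range_Phi_ind: Bu => {u}.
- by move=> y; rewrite mul1r.
- move=> u v Hu Hv y Hy.
  by rewrite mulrDl; exact: (coeff_atD_eq0 (Hu y Hy) (Hv y Hy)).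
- move=> c u Hu y Hy.
  by rewrite -scalerAl; exact: (coeff_atZ_eq0 _ (Hu y Hy)).
- by move=> u v Hu Hv y Hy; rewrite -mulrA; exact: (Hu (v * y) (Hv y Hy)).
by move=> nu y _; exact: phi_e_left_coeff0.
Qed.

Lemma range_Phi_right_coeff0 (g : Gam) (u y : T) :
  range (@env_Phi k G) u -> coeff_at (- val g) 1 g y = 0 ->
  coeff_at (- val g) 1 g (y * u) = 0.
Proof.
move=> Bu; move: y; elim/range_Phi_ind: Bu => {u}.
- by move=> y; rewrite mulr1.
- move=> u v Hu Hv y Hy.
  by rewrite mulrDr; exact: (coeff_atD_eq0 (Hu y Hy) (Hv y Hy)).
- move=> c u Hu y Hy.
  by rewrite -scalerAr; exact: (coeff_atZ_eq0 _ (Hu y Hy)).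
- by move=> u v Hu Hv y Hy; rewrite mulrA; exact: (Hv (y * u) (Hu y Hy)).
by move=> nu y _; exact: phi_e_right_coeff0.
Qed.

(** * Cofactors of b (1 - b) in ideals *)

Lemma zeltM_coeff_eq0 (y : T) (g : Gam) : (zelt * y)@_g = 0 -> y@_g = 0.
Proof.
by rewrite mcoeff_zeltM => /eqP; rewrite mulf_eq0 (negPf zpoly_neq0) => /eqP.
Qed.

(** For a generator, cancelling b (1 - b) shows that the whole coefficient of the cofactor at g is
    zero. Multiplication by B preserves only its vanishing at (0,0), which is what survives in the
    conclusion. *)
Lemma left_ideal_coeff0 (S : set T) (g : Gam) x :
  (forall s, S s -> (exists y, s = zelt * y) /\ s@_g = 0) ->
  left_ideal_gen (range (@env_Phi k G)) S x ->
  exists2 y, x = zelt * y & coeff_at 0 0 g y = 0.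
Proof.
move=> HS; elim=> [|u s {}x Bu /HS[[y ->] /zeltM_coeff_eq0 y0] _ [w -> w0]].
  by exists 0; rewrite ?mulr0 // coeff_at_eq0 ?mcoeff0.
exists (u * y + w); first by rewrite mulrDr !mulrA zelt_comm.
apply: coeff_atD_eq0 w0; apply: range_Phi_left_coeff0 Bu _.
exact: coeff_at_eq0.
Qed.

Lemma right_ideal_coeff0 (S : set T) (g : Gam) x :
  (forall s, S s -> (exists y, s = zelt * y) /\ s@_g = 0) ->
  right_ideal_gen (range (@env_Phi k G)) S x ->
  exists2 y, x = zelt * y & coeff_at (- val g) 1 g y = 0.
Proof.
move=> HS; elim=> [|s u {}x /HS[[y ->] /zeltM_coeff_eq0 y0] Bu _ [w -> w0]].
  by exists 0; rewrite ?mulr0 // coeff_at_eq0 ?mcoeff0.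
exists (y * u + w); first by rewrite mulrDr !mulrA.
apply: coeff_atD_eq0 w0; apply: range_Phi_right_coeff0 Bu _.
exact: coeff_at_eq0.
Qed.

Lemma ideal_gen_zeltM (B : set T) (w x : T) :
  ideal_gen B [set zelt * w] x -> exists y, x = zelt * y.
Proof.
elim=> [|u _ v {}x _ -> _ _ [y ->]]; first by exists 0; rewrite mulr0.
by exists (u * w * v + y); rewrite mulrDr !mulrA zelt_comm.
Qed.

(** Since k[a,b] is a domain, b (1 - b) cancels and the coefficient of y at g is the constant c,
    whatever the point of evaluation. *)
Lemma zeltM_const_coeff (c a0 b0 : k) (g : Gam) (y : T) :
  zelt * skew_mono c%:P%:P g = zelt * y -> coeff_at a0 b0 g y = c.
Proof.
move/(congr1 (mcoeff g)) => E.
have := etrans (esym (mcoeff_zeltM _ g)) (etrans E (mcoeff_zeltM y g)).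
rewrite mcoeffUU => /(mulfI zpoly_neq0).
by rewrite /coeff_at => <-; rewrite !hornerC.
Qed.

(** * The value Phi(p_mu) and the elements of I *)

Lemma env_PhiB x y : env_Phi (x - y) = env_Phi x - (env_Phi y : T).
Proof. exact: linear_zmod (@env_Phi_linear k G) x y. Qed.

Lemma env_PhiZ (c : k) x : env_Phi (c *: x) = c *: (env_Phi x : T).
Proof.
have Phi0 : env_Phi 0 = 0 :> T.
  exact: etrans (congr1 (@env_Phi k G) (esym (subrr 0)))
    (etrans (env_PhiB 0 0) (subrr _)).
have := @env_Phi_linear k G c x 0; rewrite addr0 => E.
exact: etrans E (etrans (congr1 _ Phi0) (addr0 _)).
Qed.

Lemma env_PhiM_e (nu rho : Gam) : env_Phi (env_e nu * env_e rho) =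
  skew_mono (('X + 'X%:P * (val rho)%:P%:P) *
    ('X + (val rho)%:P%:P + 'X%:P * (val nu)%:P%:P)) (rho + nu).
Proof.
apply: etrans (env_PhiM _ _) _.
apply: etrans (congr2 *%R (env_Phi_e rho) (env_Phi_e nu)) _.
by rewrite skewM shift_linear.
Qed.

Lemma Phi_p_elt (mu : Gam) :
  env_Phi (p_elt mu) = zelt * skew_mono (val mu ^+ 2)%:P%:P (mu *+ 4).
Proof.
rewrite /p_elt.
have E1 := env_PhiM_e mu (mu *+ 3).
have E2 := env_PhiM_e (mu *+ 2) (mu *+ 2).
have E3 := etrans (env_PhiZ (val mu) _) (congr1 _ (env_Phi_e (mu *+ 4))).
apply: etrans (env_PhiB _ _) _.
apply: etrans (congr2 (fun u v : T => u - v)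
  (etrans (env_PhiB _ _) (congr2 (fun u v : T => u - v) E1 E2)) E3) _.
rewrite skewZU skewM -mulrSr -mulrnDr add0r shift0.
rewrite /skew_mono -!monalgUB; congr (<< _ *g _ >>).
rewrite !raddfMn /= !rmorphXn /= /zpoly.
(* With m for mu, the identity is (a + 3mb)(a + 3m + mb) - (a + 2mb)(a + 2m + 2mb) - m(a + 4mb) =
   m^2 b (1 - b). *)
by move: (_%:P%:P) => m; ring.
Qed.

(** The commutator of Phi(e_nu) with c t^g is c ((a + b nu) - (a + g + b nu)) t^(g + nu), in which a
    and b cancel. Taking nu = h - g reaches any h. *)
Lemma zelt_mono_ideal (c : k) (g h : Gam) :
  let w := zelt * skew_mono c%:P%:P g in
  ideal_gen (range (@env_Phi k G)) [set w]
    (zelt * skew_mono (- (c * val g))%:P%:P h).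
Proof.
set B := range _; set nu := h - g => w.
have BZ (c0 : k) : B c0%:A.
  by exists (c0%:A) => //; exact: etrans (env_PhiZ _ _) (congr1 _ (env_Phi1 _)).
have B1 : B 1 by have := BZ 1; rewrite scale1r.
have BN1 : B (- 1) by have := BZ (- 1); rewrite scaleN1r.
have Be : B (phi_e nu) by exists (env_e nu) => //; exact: env_Phi_e.
have E : phi_e nu * w - w * phi_e nu = zelt * skew_mono (- (c * val g))%:P%:P h.
  apply: etrans (commutator_mul_central _ (zelt_comm _)) _; congr (_ * _).
  rewrite (skewM _ nu) (skewM _ g) (addrC g) subrK shiftC shift_linear.
  rewrite -monalgUB; congr (<< _ *g _ >>).
  by rewrite !raddfN /= !rmorphM /=; ring.
by rewrite -E; exact: ideal_gen_commutator.
Qed.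

(** The multiples of mu are pairwise distinct in characteristic zero, while the supports of the
    elements of [l] are finite. *)
Lemma exists_mcoeff_eq0 (mu : Gam) (l : seq T) :
  [pchar k] =i pred0 -> mu != 0 ->
  exists g : Gam, forall x, x \in l -> x@_g = 0.
Proof.
move=> char0 mu0.
have f_inj : injective (fun i : nat => mu *+ i).
  move=> i j /(congr1 val); rewrite !raddfMn; exact: mulrn_inj_pchar0.
have [i Hi] :=
  injective_fresh (flatten [seq (msupp x : seq Gam) | x <- l]) f_inj.
exists (mu *+ i) => x xl; apply: mcoeff_outdom; apply: contra Hi => Hi.
by apply/flattenP; exists (msupp x : seq Gam) => //; apply: map_f.
Qed.

End ImageOfPhi.

Theorem proposition4p3 (k : closedFieldType) (k_char0 : [pchar k] =i pred0)
    (Gamma : zmodClosed k) (Gamma_fg : fg_subgroup Gamma)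
    (mu : subgroup_type Gamma) (mu_neq0 : mu != 0) :
  let B : set (skew_alg Gamma) := range (@env_Phi k Gamma) in
  let I : set (skew_alg Gamma) := ideal_gen B [set env_Phi (p_elt mu)] in
  ~ fg_left_ideal B I /\ ~ fg_right_ideal B I.
Proof.
move=> B I.
have I_zelt x : I x -> exists y, x = zelt Gamma * y.
  by rewrite /I Phi_p_elt; exact: ideal_gen_zeltM.
(* The constant given by [zelt_mono_ideal] for Phi(p_mu) = mu^2 b (1 - b) t^(4 mu); it is - 4 mu^3,
   nonzero in characteristic zero. *)
pose c := - (val mu ^+ 2 * val (mu *+ 4)).
have c_neq0 : c != 0.
  rewrite oppr_eq0 raddfMn -mulr_natr !mulf_neq0 //.
  by rewrite (pcharf0P k).1.
have zelt_I h : I (zelt Gamma * skew_mono c%:P%:P h).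
  by rewrite /I Phi_p_elt; exact: zelt_mono_ideal.
split=> -[s [sI Is]]; have [g sg] := exists_mcoeff_eq0 s k_char0 mu_neq0.
  (* With g outside all supports of the generators, the cofactor of c b (1 - b) t^g would have a
     coefficient at g that both equals c and vanishes at (0,0). *)
  have := zelt_I g; rewrite Is => /(left_ideal_coeff0 (g := g)).
  case=> [x xs|y /(@zeltM_const_coeff _ _ _ 0 0) -> /eqP].
    by split; [exact: I_zelt (sI x xs) | exact: sg].
  by rewrite (negPf c_neq0).
have := zelt_I g; rewrite Is => /(right_ideal_coeff0 (g := g)).
case=> [x xs|y /(@zeltM_const_coeff _ _ _ (- val g) 1) -> /eqP].
  by split; [exact: I_zelt (sI x xs) | exact: sg].
by rewrite (negPf c_neq0).
Qed.
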